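(* Let $K$ be a field of arbitrary characteristic and let $R=\bigoplus_{n\geq 0}R_n$ be a finitely generated graded associative $K$-algebra with $R_0=0$ or $R_0=K$. If the Gelfand-Kirillov dimension $\mathrm{GKdim}(R)$ is finite, then the Hilbert series $H(R,t)=\sum_{n\geq 0}\dim_K(R_n)t^n$ is either rational or transcendental over $\mathbb{Q}(t)$; that is, if $H(R,t)$ is algebraic over $\mathbb{Q}(t)$, then it is a rational function in $\mathbb{Q}(t)$.
   Context: A $K$-algebra $R$ is graded if it is a direct sum of vector subspaces $R_0,R_1,R_2,\ldots$ (its homogeneous components) with $R_mR_n\subset R_{m+n}$ for all $m,n\geq 0$. It is assumed that $R_0=0$ or $R_0=K$; for a finitely generated $R$ all the components $R_n$ are then finite dimensional. The Hilbert series of $R$ is the formal power series $H(R,t)=\sum_{n\geq 0}\dim_K(R_n)t^n$. If $R$ is generated as an algebra by a finite dimensional vector space $V$, its growth function is $g_V(n)=\dim_K(V^0+V^1+\cdots+V^n)$, $n=0,1,2,\ldots$, where $V^i$ is the span of all products of $i$ elements of $V$ (and $V^0=K$ if $R$ is unital, $V^0=0$ otherwise). The Gelfand-Kirillov dimension is $\mathrm{GKdim}(R)=\limsup_{n\to\infty}\log_n(g_V(n))$; it does not depend on the choice of $V$. A power series $a(t)$ is rational if it is (the expansion at $0$ of) an element of $\mathbb{Q}(t)$, algebraic if $p(t,a(t))=0$ for some nonzero polynomial $p(t,z)\in\mathbb{Q}[t,z]$, and transcendental if it is not algebraic. *)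

(* Defs.v *)
From HB Require Import structures.
From mathcomp Require Import all_boot all_order all_algebra.
From mathcomp Require Import all_classical all_reals all_analysis.
Set Implicit Arguments.
Unset Strict Implicit.
Unset Printing Implicit Defensive.
Import Order.TTheory GRing.Theory Num.Theory.
Local Open Scope classical_set_scope.
Local Open Scope ring_scope.

(* No unit is required: [algType] would exclude the case R_0 = 0. *)
Record assocAlg (K : fieldType) := AssocAlg {
  alg_sort :> lmodType K;
  amul : alg_sort -> alg_sort -> alg_sort;
  amulA : associative amul;
  amulDl : left_distributive amul +%R;
  amulDr : right_distributive amul +%R;
  amulZl : forall (a : K) (x y : alg_sort), amul (a *: x) y = a *: amul x y;
  amulZr : forall (a : K) (x y : alg_sort), amul x (a *: y) = a *: amul x y
}.

Section LinearAlgebra.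
Variables (K : fieldType) (W : lmodType K).
Implicit Types (U A : set W).

Definition is_subspace U : Prop :=
  U 0 /\ forall (a : K) (x y : W), U x -> U y -> U (a *: x + y).

Definition lspan A : set W := smallest is_subspace A.

Definition lin_indep (d : nat) (b : 'I_d -> W) : Prop :=
  forall c : 'I_d -> K, \sum_(i < d) c i *: b i = 0 -> forall i, c i = 0.

Definition has_dim U (d : nat) : Prop :=
  exists b : 'I_d -> W, lin_indep b /\ lspan (range b) = U.

Definition finite_dim U : Prop := exists d, has_dim U d.

(* Junk value 0 when U is not a finite dimensional subspace. *)
Definition dimK U : nat := xget 0%N [set d | has_dim U d].

End LinearAlgebra.

Section Algebras.
Variables (K : fieldType) (R : assocAlg K).
Implicit Types (V S : set R) (G : nat -> set R).

Definition is_one (e : R) : Prop := forall x : R, amul e x = x /\ amul x e = x.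

(* Subalgebras of a unital algebra contain its unit, in accordance with the
   convention V^0 = K in the unital case. *)
Definition is_subalg S : Prop :=
  [/\ is_subspace S,
      forall x y, S x -> S y -> S (amul x y)
    & forall e, is_one e -> S e].

Definition generates V : Prop := smallest is_subalg V = setT.

(* The products of i elements of V; for i = 0 this is the set of identity elements
   of R, whose span is K.1 if R is unital and 0 otherwise. *)
Definition products V (i : nat) : set R :=
  match i with
  | 0%N => [set e | is_one e]
  | j.+1 => [set y | exists (x : R) (s : seq R),
      [/\ V x, forall z, z \in s -> V z, size s = j & y = foldl (@amul K R) x s]]
  end.

Definition vpow V (i : nat) : set R := lspan (products V i).

(* V^0 + V^1 + ... + V^n *)
Definition vpow_sum V (n : nat) : set R :=
  [set x | exists f : nat -> R,
     (forall i, vpow V i (f i)) /\ x = \sum_(i < n.+1) f i].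

Definition growth V (n : nat) : nat := dimK (vpow_sum V n).

(* The quotient is log_n (growth V n) for n >= 2. If R = 0 then growth V n = 0,
   and as [ln 0 = 0] the value is 0 rather than -oo. *)
Definition GKdim (RR : realType) V : \bar RR :=
  limn_esup (fun n : nat => (ln (growth V n)%:R / ln n%:R : RR)%:E).

Record is_grading G : Prop := IsGrading {
  grading_subspace : forall n, is_subspace (G n);
  grading_span : forall x : R, exists (N : nat) (f : nat -> R),
    (forall i, G i (f i)) /\ x = \sum_(i < N) f i;
  grading_direct : forall (N : nat) (f : nat -> R),
    (forall i, G i (f i)) -> \sum_(i < N) f i = 0 ->
    forall i, (i < N)%N -> f i = 0;
  grading_mul : forall m n x y, G m x -> G n y -> G (m + n)%N (amul x y)
}.

(* "R_0 = K": R is a nonzero unital algebra with R_0 = K.1 *)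
Definition degree0_is_field G : Prop :=
  exists e : R, [/\ e != 0, is_one e & G 0%N = [set c *: e | c in [set: K]]].

Definition hilbert_series G : nat -> rat := fun n => (dimK (G n))%:R.

End Algebras.

(* A formal power series over rat is represented by its coefficient sequence. *)
Section PowerSeries.
Implicit Types (a b : nat -> rat).

Definition fps_of_poly (p : {poly rat}) : nat -> rat := fun n => p`_n.

Definition fps_mul a b : nat -> rat :=
  fun n => \sum_(i < n.+1) a i * b (n - i)%N.

Definition fps_exp a (k : nat) : nat -> rat :=
  iter k (fps_mul a) (fps_of_poly 1).

(* p(t, a(t)), for p in Q[t][z] *)
Definition fps_eval (p : {poly {poly rat}}) a : nat -> rat :=
  fun n => \sum_(j < size p) fps_mul (fps_of_poly p`_j) (fps_exp a j) n.

Definition fps_rational a : Prop :=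
  exists p q : {poly rat},
    q`_0 != 0 /\ forall n, fps_mul (fps_of_poly q) a n = fps_of_poly p n.

Definition fps_algebraic a : Prop :=
  exists p : {poly {poly rat}}, p != 0 /\ forall n, fps_eval p a n = 0.

Definition fps_transcendental a : Prop := ~ fps_algebraic a.

End PowerSeries.

(* Main.v *)
Require Import Defs.
From mathcomp Require Import all_boot all_order all_algebra all_field.
From mathcomp Require Import ring zify.
From mathcomp Require Import all_classical all_reals all_analysis.
Set Implicit Arguments.
Unset Strict Implicit.
Unset Printing Implicit Defensive.
Import Order.TTheory GRing.Theory Num.Theory.
Local Open Scope classical_set_scope.
Local Open Scope ring_scope.

(** Each R_n lies in V^0 + ... + V^(kn) for a fixed k, so dim R_n grows at most
    polynomially in n. What remains is Fatou's theorem for a series a with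
    natural coefficients of polynomial growth. If p(t, a) = 0 with leading
    coefficient c in Z[t], then g = c a has integer coefficients and is a root
    of a monic polynomial over Q[t], hence is bounded on the open unit disc; by
    Parseval the sum of the squares of its coefficients is finite, so g is a
    polynomial and a = g / c.

    The analysis is finitary: a is truncated at order T, where p(t, a_T) is
    divisible by t^T and hence small on the circle of radius r < 1 for T large,
    and Parseval is applied to roots of unity in algC. *)

(** * Norms of polynomials and discrete Parseval *)

Section PolyNorm.
Variable R : numDomainType.
Implicit Types (p q : {poly R}).

(** The l^1 norm of the coefficients: submultiplicative, and an upper bound for [p] on the closed
    unit disc. *)
Definition pnorm p : R := \sum_(i < size p) `|p`_i|.

Lemma pnorm_wide n p : (size p <= n)%N -> pnorm p = \sum_(i < n) `|p`_i|.
Proof.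
move=> le_pn; rewrite /pnorm (big_ord_widen n (fun i => `|p`_i|)) // big_mkcond.
by apply: eq_bigr => i _; case: ltnP => // /(nth_default 0) ->; rewrite normr0.
Qed.

Lemma pnorm_ge0 p : 0 <= pnorm p.
Proof. exact: sumr_ge0. Qed.

Lemma pnorm0 : pnorm 0 = 0.
Proof. by rewrite /pnorm size_poly0 big_ord0. Qed.

Lemma pnorm1 : pnorm 1 = 1.
Proof. by rewrite (@pnorm_wide 1) ?size_poly1 // big_ord1 coef1 normr1. Qed.

Lemma pnormD p q : pnorm (p + q) <= pnorm p + pnorm q.
Proof.
have szm := leq_maxl (size p) (size q); have szM := leq_maxr (size p) (size q).
rewrite (pnorm_wide (size_polyD p q)) (pnorm_wide szm) (pnorm_wide szM).
rewrite -big_split; apply: ler_sum => i _ /=.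
by rewrite coefD ler_normD.
Qed.

Lemma pnorm_sum (I : Type) (r : seq I) (P : pred I) (F : I -> {poly R}) :
  pnorm (\sum_(i <- r | P i) F i) <= \sum_(i <- r | P i) pnorm (F i).
Proof.
elim/big_rec2: _ => [|i y x _ le_xy]; first by rewrite pnorm0.
by apply: le_trans (pnormD _ _) _; rewrite lerD2l.
Qed.

Lemma pnorm_mulXaddC p c : pnorm (p * 'X + c%:P) = `|c| + pnorm p.
Proof.
rewrite (@pnorm_wide (size p).+1); last first.
  by rewrite size_MXaddC; case: ifP.
rewrite big_ord_recl coefD coefMX coefC /= add0r; congr (_ + _).
by apply: eq_bigr => i _; rewrite coefD coefMX coefC /= addr0.
Qed.

(** Induction along Horner's scheme: multiplication by ['X] preserves the norm and multiplication by
    a constant scales it. *)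
Lemma pnormM p q : pnorm (p * q) <= pnorm p * pnorm q.
Proof.
elim/poly_ind: p => [|p c IHp]; first by rewrite mul0r pnorm0 mul0r.
rewrite pnorm_mulXaddC mulrDl -mulrA -commr_polyX mulrA mulrDl addrC.
apply: le_trans (pnormD _ _) (lerD _ _).
  rewrite mul_polyC (@pnorm_wide (size q)) ?size_scale_leq // mulr_sumr.
  by apply: ler_sum => i _; rewrite coefZ normrM.
by have /= := pnorm_mulXaddC (p * q) 0; rewrite addr0 normr0 add0r => ->.
Qed.

Lemma pnorm_exp p n : pnorm (p ^+ n) <= pnorm p ^+ n.
Proof.
elim: n => [|n IHn]; first by rewrite !expr0 pnorm1.
by rewrite !exprS (le_trans (pnormM _ _)) // ler_wpM2l ?pnorm_ge0.
Qed.

Lemma pnorm_horner_bound T p (z r : R) :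
    `|z| <= r -> r <= 1 -> (forall n, (n < T)%N -> p`_n = 0) ->
  `|p.[z]| <= pnorm p * r ^+ T.
Proof.
move=> zr r1 p0; have r0 : 0 <= r by apply: le_trans zr.
rewrite horner_coef /pnorm mulr_suml; apply: le_trans (ler_norm_sum _ _ _) _.
apply: ler_sum => i _; rewrite normrM normrX.
have [/p0 -> | leTi] := ltnP i T; first by rewrite normr0 !mul0r.
rewrite ler_wpM2l //; apply: (@le_trans _ _ (r ^+ i)); first by rewrite lerXn2r ?nnegrE.
exact: ler_wiXn2l.
Qed.

End PolyNorm.

(** If [|x| > 1], dividing the equation by [x ^+ d] leaves at most [1 + B]. An error of size 1 is
    allowed because truncations satisfy the monic equation only approximately. *)
Lemma root_norm_bound (R : numFieldType) d (q : 'I_d.+1 -> R) (x B : R) :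
    `|x ^+ d.+1 + \sum_(j < d.+1) q j * x ^+ j| <= 1 ->
    \sum_(j < d.+1) `|q j| <= B ->
  `|x| <= 1 + B.
Proof.
move=> le_e le_B; have B0 : 0 <= B by apply: le_trans le_B; apply: sumr_ge0.
have [x1 | x1] := real_leP (normr_real x) (real1 R).
  by apply: le_trans x1 _; rewrite lerDl.
have x0 : 0 < `|x| ^+ d by rewrite exprn_gt0 // (lt_trans ltr01).
rewrite -(ler_pM2r x0) -exprS -normrX.
set s := \sum_(j < _) _ * _ in le_e.
rewrite -[X in `|X|](addrK s) mulrDl mul1r.
apply: le_trans (ler_normB _ _) (lerD _ _).
  by apply: le_trans le_e _; rewrite exprn_ege1 // ltW.
apply: (@le_trans _ _ ((\sum_(j < d.+1) `|q j|) * `|x| ^+ d)); last first.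
  by rewrite ler_wpM2r // ltW.
rewrite mulr_suml; apply: le_trans (ler_norm_sum _ _ _) (ler_sum _ _) => j _.
rewrite normrM normrX ler_wpM2l // ler_weXn2l ?(ltW x1) //.
by rewrite -ltnS.
Qed.

Lemma unity_root_sum (F : fieldType) N (x : F) :
  x ^+ N = 1 -> \sum_(k < N) x ^+ k = if x == 1 then N%:R else 0.
Proof.
move=> xN; case: eqVneq => [-> | x1].
  under eq_bigr do rewrite expr1n.
  by rewrite sumr_const card_ord.
apply: (mulfI (x := x - 1)); first by rewrite subr_eq0.
by rewrite -subrX1 xN subrr mulr0.
Qed.

(** Expanding each square and exchanging sums leaves geometric sums of [w ^+ n / w ^+ m], which
    vanish unless [n = m]. *)
Lemma discrete_parseval N (w : algC) (c : 'I_N -> algC) :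
    N.-primitive_root w ->
  \sum_(k < N) `|\sum_(n < N) c n * (w ^+ k) ^+ n| ^+ 2 =
    N%:R * \sum_(n < N) `|c n| ^+ 2.
Proof.
move=> prim_w; have N0 := prim_order_gt0 prim_w.
have wN := prim_expr_order prim_w.
have w_nz : w != 0.
  apply/eqP => w0; move/eqP: wN.
  by rewrite w0 expr0n gtn_eqF // eq_sym oner_eq0.
have wn1 : `|w| = 1.
  by apply/eqP; rewrite -(pexpr_eq1 N0) // -normrX wN normr1.
have wJ : w^* = w^-1 by rewrite invC_norm wn1 expr1n invr1 mul1r.
transitivity (\sum_(n < N) \sum_(m < N)
    c n * (c m)^* * \sum_(k < N) (w ^+ n / w ^+ m) ^+ k).
  under eq_bigr => k _.
    rewrite normCK rmorph_sum mulr_suml.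
    under eq_bigr => n _ do rewrite mulr_sumr.
    over.
  rewrite exchange_big; apply: eq_bigr => n _ /=.
  rewrite exchange_big; apply: eq_bigr => m _ /=.
  rewrite mulr_sumr; apply: eq_bigr => k _.
  rewrite rmorphM !rmorphXn /= wJ exprMn !exprVn -!exprM (mulnC k) (mulnC k).
  by rewrite mulrACA.
rewrite [RHS]mulr_sumr; apply: eq_bigr => n _.
rewrite (bigD1 n) //= [X in _ + X]big1 ?addr0 => [|m m_n].
  rewrite divff ?expf_neq0 //; under eq_bigr do rewrite expr1n.
  by rewrite sumr_const card_ord -normCK mulrC.
rewrite unity_root_sum; last first.
  by rewrite exprMn exprVn -!exprM !(mulnC _ N) !exprM (prim_expr_order prim_w) !expr1n divr1.
rewrite ifF ?mulr0 //; apply/negbTE.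
apply: contraNneq m_n => /(congr1 ( *%R^~ (w ^+ m))); rewrite mulfVK ?expf_neq0 // mul1r.
move/eqP; rewrite (eq_prim_root_expr prim_w) !modn_small // => /eqP nm.
by apply/eqP/val_inj.
Qed.

(** In terms of [r = q / (q + 1)] this is [K * T ^ m * r ^ T <= 1]. Since [(1 + 1/q) ^ q >= 2],
    taking [T = q * u] reduces it to [K * (q * u) ^ m <= 2 ^ u], which holds for a suitable power
    [u] of 2. *)
Lemma expn_poly_growth (K m q : nat) : (0 < q)%N ->
  exists2 T, (q <= T)%N & (K * T ^ m * q ^ T <= q.+1 ^ T)%N.
Proof.
move=> q0.
(* The first two terms of the binomial expansion are both [q ^ q]. *)
have dbl : (2 * q ^ q <= q.+1 ^ q)%N.
  case: q q0 => // q _.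
  have := expnDn q.+1 1 q.+1; rewrite addn1 => ->.
  rewrite !big_ord_recl /= /bump /= bin0 bin1 !exp1n !muln1 subn0 mul1n add1n.
  by rewrite subSS subn0 -expnS mul2n -addnn addnA leq_addr.
have sq x : (4 <= x -> x * x <= 2 ^ x)%N.
  elim: x => // x IHx; rewrite leq_eqVlt => /predU1P[<- // | lt3x].
  have {}IHx := IHx lt3x; rewrite expnS; set y := (2 ^ x)%N in IHx *.
  by clearbody y; nia.
have [b def_b] : exists b, b = (K * q ^ m)%N by exists (K * q ^ m)%N.
(* These bounds give [b + v * m <= v * v <= 2 ^ v], the comparison of exponents needed for
   [u = 2 ^ v]. *)
have [v [v4 le_bv le_mv]] : exists v, [/\ 4 <= v, b <= v & m < v]%N.
  by exists (b + m + 4)%N; split; lia.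
have le_u : (b * (2 ^ v) ^ m <= 2 ^ (2 ^ v))%N.
  apply: (@leq_trans (2 ^ b * (2 ^ v) ^ m)).
    by rewrite leq_mul2r ltnW ?orbT // ltn_expl.
  rewrite -expnM -expnD leq_exp2l //; apply: leq_trans (sq _ v4).
  by nia.
have u0 : (0 < 2 ^ v)%N by rewrite expn_gt0.
move: (2 ^ v)%N u0 le_u => u u0 le_u.
exists (q * u)%N; first by rewrite leq_pmulr.
rewrite expnMn mulnA -def_b !expnM.
apply: leq_trans (_ : (2 * q ^ q) ^ u <= _)%N; last by rewrite leq_exp2r.
by rewrite expnMn leq_mul.
Qed.

Lemma bernoulli_ineq (R : numDomainType) (r : R) k :
  0 <= r -> r <= 1 -> 1 - k%:R * (1 - r) <= r ^+ k.
Proof.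
move=> r0 r1; elim: k => [|k IHk]; first by rewrite mul0r subr0.
rewrite -natr1 mulrDl mul1r opprD addrA exprSr.
apply: (@le_trans _ _ (r ^+ k - (1 - r))); first by rewrite lerD2r.
rewrite -subr_ge0 (_ : _ - _ = (1 - r ^+ k) * (1 - r)); last by ring.
by rewrite mulr_ge0 // subr_ge0 // exprn_ile1.
Qed.

(** Induction on the bound: past a positive term, the tail has sums bounded by one less. *)
Lemma bounded_sum_eventually0 (u : nat -> nat) (B : nat) :
    (forall S, (\sum_(n < S) u n <= B)%N) ->
  exists S, forall n, (S <= n)%N -> u n = 0%N.
Proof.
elim: B u => [|B IHB] u leB.
  by exists 0%N => n _; have := leB n.+1; rewrite big_ord_recr /=; lia.
have [[S u_pos] | u0] := pselect (exists n, 0 < u n)%N; last first.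
  by exists 0%N => n _; apply/eqP; rewrite -leqn0 leqNgt; apply/negP => un; case: u0; exists n.
have [S' u0] : exists S', forall n, (S' <= n)%N -> u (S.+1 + n)%N = 0%N.
  apply: (IHB (fun n => u (S.+1 + n)%N)) => S'.
  have := leB (S.+1 + S')%N; rewrite big_split_ord /= big_ord_recr /=; lia.
exists (S.+1 + S')%N => n len.
by rewrite -(subnKC (leq_trans (leq_addr _ _) len)) u0 //; lia.
Qed.

(* Multiplying an equation of degree d+1 by the d-th power of its leading
   coefficient makes it monic in [lead_coef p * x]. *)
Lemma horner_monic_form (R : comNzRingType) (p : {poly R}) (x : R) d :
    size p = d.+2 ->
  lead_coef p ^+ d * p.[x] = (lead_coef p * x) ^+ d.+1 +
    \sum_(j < d.+1) (p`_j * lead_coef p ^+ (d - j)) * (lead_coef p * x) ^+ j.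
Proof.
move=> szp; rewrite horner_coef szp big_ord_recr /= -[p`_d.+1]/(p`_(d.+2.-1)) -szp -/(lead_coef p).
rewrite addrC mulrDr exprMn exprSr mulrA; congr (_ + _).
  by rewrite -exprSr.
rewrite mulr_sumr; apply: eq_bigr => j _.
have /subnK/(congr1 (GRing.exp (lead_coef p))) : (j <= d)%N by rewrite -ltnS.
by rewrite exprD => <-; rewrite exprMn; ring.
Qed.

(** * Truncations of an algebraic series on a circle inside the unit disc *)

Section AlgebraicSeries.
Variables (p : {poly {poly algC}}) (a : nat -> algC) (d D A : nat).
Hypothesis szp : size p = d.+2.
Hypothesis a_bound : forall n, `|a n| <= (D * n.+1 ^ A)%:R.
Hypothesis p_root : forall T n, (n < T)%N -> (p.[\poly_(i < T) a i])`_n = 0.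

Let c := lead_coef p.
Let trunc T := \poly_(i < T) a i.
(** [B0] bounds the lower coefficients of the monic equation for [c * trunc T], and [L] is the
    factor free of [T] in the bound on its error term [c ^+ d * p.[trunc T]]. *)
Let B0 := \sum_(j < d.+1) pnorm p`_j * pnorm c ^+ (d - j).

Let L := pnorm c ^+ d * \sum_(j < d.+2) pnorm p`_j.

(** With [D.+1] in place of [D] the bound is at least 1 for [T > 0], so its powers increase with the
    exponent. *)
Lemma pnorm_trunc T : pnorm (trunc T) <= (D.+1 * T ^ A.+1)%:R.
Proof.
rewrite (@pnorm_wide _ T) ?size_poly //.
apply: (@le_trans _ _ (\sum_(i < T) (D * T ^ A)%:R)).
  apply: ler_sum => i _; rewrite coef_poly ltn_ord.
  apply: le_trans (a_bound i) _; rewrite ler_nat leq_mul2l orbC.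
  by case: (A) => [|k]; rewrite ?expn0 // leq_exp2r // ltn_ord.
rewrite sumr_const card_ord -mulrnA ler_nat expnSr mulnA leq_mul2r.
by rewrite leq_mul2r leqnSn !orbT.
Qed.

Lemma pnorm_horner_trunc T : (0 < T)%N ->
  pnorm (c ^+ d * p.[trunc T]) <= L * (D.+1 * T ^ A.+1)%:R ^+ d.+1.
Proof.
move=> T0; apply: le_trans (pnormM _ _) _; rewrite -mulrA.
apply: ler_pM; rewrite ?pnorm_ge0 ?pnorm_exp //.
rewrite horner_coef szp mulr_suml; apply: le_trans (pnorm_sum _ _ _) _.
apply: ler_sum => j _; apply: le_trans (pnormM _ _) _.
rewrite ler_wpM2l ?pnorm_ge0 //; apply: le_trans (pnorm_exp _ _) _.
apply: (@le_trans _ _ ((D.+1 * T ^ A.+1)%:R ^+ j)).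
  by rewrite lerXn2r ?nnegrE ?ler0n ?pnorm_ge0 // pnorm_trunc.
rewrite ler_weXn2l ?ler1n ?muln_gt0 ?expn_gt0 ?T0 //.
by rewrite -ltnS.
Qed.

(** The error term of the monic equation is divisible by ['X^T], so at [z] it is at most its norm
    times [r ^+ T], and [root_norm_bound] applies. *)
Lemma lead_mul_trunc_bound T (z r : algC) :
    (0 < T)%N -> `|z| <= r -> r <= 1 ->
    L * (D.+1 * T ^ A.+1)%:R ^+ d.+1 * r ^+ T <= 1 ->
  `|(c * trunc T).[z]| <= 1 + B0.
Proof.
move=> T0 zr r1 le_err; have r0 : 0 <= r by apply: le_trans zr.
have hz q : `|q.[z]| <= pnorm q.
  by have := @pnorm_horner_bound _ 0 q z r zr r1; rewrite expr0 mulr1; apply.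
pose q (j : 'I_d.+1) := (p`_j * c ^+ (d - j)).[z].
apply: (@root_norm_bound _ d q); last first.
  apply: ler_sum => j _; apply: le_trans (hz _) _.
  apply: le_trans (pnormM _ _) _.
  by rewrite ler_wpM2l ?pnorm_ge0 ?pnorm_exp.
apply: le_trans le_err.
rewrite (_ : _ + _ = (c ^+ d * p.[trunc T]).[z]); last first.
  rewrite (horner_monic_form _ szp) hornerD horner_exp horner_sum; congr (_ + _).
  by apply: eq_bigr => j _; rewrite /q !(hornerM, horner_exp).
apply: (@le_trans _ _ (pnorm (c ^+ d * p.[trunc T]) * r ^+ T)); last first.
  by rewrite ler_wpM2r ?exprn_ge0 // pnorm_horner_trunc.
apply: pnorm_horner_bound => // n ltnT.
rewrite coefM big1 // => i _; rewrite p_root ?mulr0 //.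
by apply: leq_ltn_trans ltnT; rewrite leq_subr.
Qed.

(** Parseval on the circle of radius [r] bounds the sum of squares weighted by [r ^+ (2 * n)]. For
    given [S], first [r] is taken so close to 1 that the weights below [S] are at least 1/2, then
    [T] so large that the error is at most 1; the bound does not depend on [S]. *)
Lemma lead_mul_trunc_sum_sqr : exists B : nat, forall S, exists2 T, (S <= T)%N &
  \sum_(n < S) `|(c * trunc T)`_n| ^+ 2 <= B%:R.
Proof.
have B0_ge0 : 0 <= B0.
  by apply: sumr_ge0 => j _; rewrite mulr_ge0 ?exprn_ge0 ?pnorm_ge0.
have L_ge0 : 0 <= L.
  rewrite mulr_ge0 ?exprn_ge0 ?pnorm_ge0 //.
  by apply: sumr_ge0 => j _; apply: pnorm_ge0.
pose M := 1 + B0; have M0 : 0 <= M by rewrite addr_ge0.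
exists (Num.bound (2 * M ^+ 2)) => S.
(* With [r = q / q.+1] one has [1 - r = 1 / (4 * S + 4)], so Bernoulli gives [r ^+ (2 * S) >= 1/2];
   moreover [q <= T] forces [S <= T] and [T > 0]. *)
pose q := (4 * S + 3)%N.
pose K := (Num.bound L * D.+1 ^ d.+1)%N.
have [|T leqT leT] := @expn_poly_growth K (A.+1 * d.+1) q; first by rewrite /q; lia.
have T0 : (0 < T)%N by rewrite /q in leqT; lia.
have leST : (S <= T)%N by rewrite /q in leqT; lia.
exists T => //.
pose r : algC := q%:R / q.+1%:R.
have q1 : 0 < q.+1%:R :> algC by rewrite ltr0n.
have r_ge0 : 0 <= r by rewrite divr_ge0 ?ler0n.
have r_le1 : r <= 1 by rewrite ler_pdivrMr // mul1r ler_nat.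
have err : L * (D.+1 * T ^ A.+1)%:R ^+ d.+1 * r ^+ T <= 1.
  rewrite expr_div_n mulrA ler_pdivrMr ?exprn_gt0 // mul1r -!natrX.
  apply: (@le_trans _ _ (K * T ^ (A.+1 * d.+1) * q ^ T)%:R); last by rewrite ler_nat.
  rewrite natrM ler_wpM2r ?ler0n // /K -mulnA natrM expnMn -expnM.
  by rewrite ler_wpM2r ?ler0n // ltW // archi_boundP.
have r_half k : (k <= 2 * S)%N -> 2^-1 <= r ^+ k.
  move=> lek; apply: le_trans (bernoulli_ineq k r_ge0 r_le1).
  have -> : 1 - r = q.+1%:R^-1 by rewrite /r -natr1; field; rewrite natr1 gt_eqF.
  rewrite lerBrDl -lerBrDr (_ : 1 - 2^-1 = 2^-1); last by field.
  rewrite ler_pdivrMr // ler_pdivlMl ?ltr0n // -natrM ler_nat /q; lia.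
(* There are more sample points than coefficients, so Parseval sees every coefficient separately;
   the summand [S] lets the sum over [n < S] embed. *)
pose N := (size (c * trunc T) + S).+1.
have N0 : (0 < N)%N by [].
have leN : (size (c * trunc T)%R <= N)%N by rewrite /N; lia.
have leSN : (S <= N)%N by rewrite /N; lia.
have [w prim_w] := C_prim_root_exists N0.
have wn k : `|w ^+ k| = 1.
  apply/eqP; rewrite normrX -(pexpr_eq1 N0) ?exprn_ge0 // -exprM mulnC exprM.
  by rewrite -normrX (prim_expr_order prim_w) normr1 expr1n.
pose h n := (c * trunc T)`_n * r ^+ n.
have := @discrete_parseval _ _ (fun n : 'I_N => h n) prim_w.
set lhs := \sum_(k < _) _ => defl.
have le_l : lhs <= N%:R * M ^+ 2.
  apply: (@le_trans _ _ (\sum_(k < N) M ^+ 2)); last first.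
    by rewrite sumr_const card_ord mulr_natl.
  apply: ler_sum => k _.
  rewrite lerXn2r ?nnegrE //.
  have -> : \sum_(n < N) h n * (w ^+ k) ^+ n = (c * trunc T).[r * w ^+ k].
    rewrite (@horner_coef_wide _ N) //.
    by apply: eq_bigr => n _; rewrite exprMn mulrA.
  apply: (@lead_mul_trunc_bound _ _ r) => //.
  by rewrite normrM wn mulr1 ger0_norm.
rewrite defl ler_pM2l ?ltr0n // in le_l.
apply: le_trans (ltW (archi_boundP _)); last by rewrite mulr_ge0 ?exprn_ge0 ?ler0n.
rewrite -ler_pdivrMl ?ltr0n // mulr_sumr; apply: le_trans le_l.
rewrite (big_ord_widen _ (fun n => 2^-1 * `|(c * trunc T)`_n| ^+ 2) leSN).
rewrite big_mkcond; apply: ler_sum => n _; case: ifP => ltnS; last by rewrite exprn_ge0.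
rewrite /h normrM exprMn mulrC ler_wpM2l ?exprn_ge0 //.
by rewrite normrX (ger0_norm r_ge0) -exprM r_half //; lia.
Qed.

End AlgebraicSeries.

(** * Fatou's theorem for polynomial growth *)

Section PowerSeriesTruncation.
Implicit Types (a b : nat -> rat).

Lemma fps_mul_coef a b (x y : {poly rat}) T :
    (forall n, (n < T)%N -> a n = x`_n) -> (forall n, (n < T)%N -> b n = y`_n) ->
  forall n, (n < T)%N -> fps_mul a b n = (x * y)`_n.
Proof.
move=> ax bY n ltnT; rewrite coefM; apply: eq_bigr => i _.
by rewrite ax ?bY // (leq_ltn_trans _ ltnT) ?leq_subr // -ltnS.
Qed.

(** Coefficients of sums and products below order [T] depend only on those of the factors below [T],
    so identities of series become congruences of polynomials modulo ['X^T]. *)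
Lemma fps_eval_coef (p : {poly {poly rat}}) a T n :
  (n < T)%N -> fps_eval p a n = (p.[\poly_(i < T) a i])`_n.
Proof.
move=> ltnT; rewrite horner_coef coef_sum; apply: eq_bigr => j _.
apply: (@fps_mul_coef _ _ _ _ T) => // {n ltnT}.
elim: (nat_of_ord j) => [n _ | k IHk n ltnT]; first by rewrite expr0.
rewrite exprS /=; apply: (@fps_mul_coef _ _ _ _ T) => // i ltiT.
by rewrite coef_poly ltiT.
Qed.

(** The denominator in [fps_rational] must have a nonzero constant term; induction on [c] cancels
    one factor ['X] at a time, shifting the coefficients of [q]. *)
Lemma fps_rational_quotient (c q : {poly rat}) a :
    c != 0 -> (forall n, fps_mul (fps_of_poly c) a n = fps_of_poly q n) ->
  fps_rational a.
Proof.
elim/poly_ind: c q => [|c k IHc] q; first by rewrite eqxx.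
have [-> | k0] := eqVneq k 0; last first.
  by move=> _ cq; exists q, (c * 'X + k%:P); split; rewrite // coefD coefMX coefC add0r.
rewrite addr0 mulf_eq0 polyX_eq0 orbF => c0 cq.
apply: (IHc (\poly_(i < size q) q`_i.+1)) => // n.
transitivity (q`_n.+1).
  rewrite -[RHS]cq /fps_mul [RHS]big_ord_recl /fps_of_poly coefMX mul0r add0r.
  by apply: eq_bigr => i _; rewrite coefMX.
rewrite /fps_of_poly coef_poly; case: ltnP => // le_q.
by rewrite nth_default // (leq_trans le_q).
Qed.

Lemma int_sqr_norm_ge1 (x : int) : x != 0 -> 1 <= `|x%:~R : algC| ^+ 2.
Proof.
by move=> x0; rewrite -intr_norm exprn_ege1 // ler1z; lia.
Qed.

Theorem fatou_polynomial_growth (u : nat -> nat) (D A : nat) :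
    (forall n, u n <= D * n.+1 ^ A)%N ->
    fps_algebraic (fun n => (u n)%:R) -> fps_rational (fun n => (u n)%:R).
Proof.
move=> leu [p [p0 pa]]; set a := (fun n : nat => (u n)%:R) in pa *.
pose tr T := \poly_(i < T) a i.
(* A nonzero [p] of degree 0 in z is excluded, as its value at the series is its constant
   coefficient. *)
have [d szp] : exists d, size p = d.+2.
  case szp: (size p) => [|[|d]]; last by exists d.
    by rewrite -size_poly_eq0 szp in p0.
  have /size_poly1P[c c0 def_p] : size p == 1%N by rewrite szp.
  case/eqP: c0; apply/polyP => n.
  by rewrite coef0 -[RHS](pa n) (fps_eval_coef _ _ (ltnSn n)) def_p hornerC.
(* Only the leading coefficient is cleared of denominators: integrality is required of [c] times the
   series, and mere boundedness of the other coefficients. *)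
have [q [N N0 def_c]] := rat_poly_scale (lead_coef p).
have NQ0 : N%:~R != 0 :> rat by rewrite intr_eq0.
pose p' := (N%:~R : rat)%:P *: p.
have szp' : size p' = d.+2 by rewrite size_scale ?polyC_eq0.
pose c := map_poly (intr : int -> rat) q.
have lead_p' : lead_coef p' = c.
  by rewrite lead_coefZ def_c mul_polyC scalerA mulfV // scale1r.
pose P := map_poly (map_poly (ratr : rat -> algC)) p'.
have mapI : injective (map_poly (ratr : rat -> algC)) by apply: map_poly_inj.
have szP : size P = d.+2 by rewrite size_map_inj_poly ?rmorph0.
have lead_P : lead_coef P = map_poly ratr c by rewrite lead_coef_map_inj ?rmorph0 // lead_p'.
pose aC n : algC := (u n)%:R.
have trC T : \poly_(i < T) aC i = map_poly ratr (tr T).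
  apply/polyP => n; rewrite coef_map !coef_poly /=.
  by case: ifP; rewrite ?rmorph0 ?rmorph_nat.
have aC_bound n : `|aC n| <= (D * n.+1 ^ A)%:R.
  by rewrite ger0_norm ?ler0n // ler_nat.
have P_root T n : (n < T)%N -> (P.[\poly_(i < T) aC i])`_n = 0.
  move=> ltnT; rewrite trC horner_map coef_map hornerZ mul_polyC coefZ /=.
  by rewrite -fps_eval_coef // pa mulr0 rmorph0.
have [B leB] := lead_mul_trunc_sum_sqr szP aC_bound P_root.
pose gz n : int := \sum_(i < n.+1) q`_i * (u (n - i)%N)%:Z.
have gzE T n : (n < T)%N -> (c * tr T)`_n = (gz n)%:~R.
  move=> ltnT; rewrite coefM rmorph_sum; apply: eq_bigr => i _.
  rewrite coef_map coef_poly rmorphM /= ifT ?pmulrn //.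
  by apply: leq_ltn_trans ltnT; rewrite leq_subr.
(* Each nonzero integer coefficient contributes at least 1 to the sum of squares, so at most [B] of
   them are nonzero. *)
have [S gz0] : exists S, forall n, (S <= n)%N -> nat_of_bool (gz n != 0) = 0%N.
  apply: (@bounded_sum_eventually0 _ B) => S.
  have [T leST le_sum] := leB S.
  rewrite -(ler_nat algC); apply: le_trans le_sum; rewrite natr_sum.
  apply: ler_sum => n _; rewrite lead_P trC -rmorphM coef_map.
  rewrite gzE ?(leq_trans _ leST) //= ratr_int.
  by case: eqVneq => [-> | /int_sqr_norm_ge1 //]; rewrite exprn_ge0.
have c0 : c != 0 by rewrite -lead_p' lead_coef_eq0 -size_poly_eq0 szp'.
apply: (@fps_rational_quotient c (\poly_(n < S) (gz n)%:~R)) => // n.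
rewrite (@fps_mul_coef _ _ c (tr n.+1) n.+1) // => [|i lti]; last by rewrite coef_poly lti.
rewrite gzE // /fps_of_poly coef_poly; case: ltnP => // /gz0.
by case: eqP => // ->.
Qed.

End PowerSeriesTruncation.

(** * Dimension of subspaces *)

Section Subspaces.
Variables (K : fieldType) (W : lmodType K).
Implicit Types (U A : set W) (x y : W).

Lemma subspace0 U : is_subspace U -> U 0.
Proof. by case. Qed.

Lemma subspaceZ U a x : is_subspace U -> U x -> U (a *: x).
Proof. by move=> [U0 Ulin] Ux; rewrite -[_ *: _]addr0; apply: Ulin. Qed.

Lemma subspaceD U x y : is_subspace U -> U x -> U y -> U (x + y).
Proof. by move=> [_ Ulin] Ux Uy; rewrite -[x]scale1r; apply: Ulin. Qed.

Lemma subspaceB U x y : is_subspace U -> U x -> U y -> U (x - y).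
Proof. by move=> subU Ux Uy; rewrite -scaleN1r; do ?[apply: subspaceD | apply: subspaceZ]. Qed.

Lemma subspace_sum U (I : Type) (r : seq I) (P : pred I) (f : I -> W) :
    is_subspace U -> (forall i, P i -> U (f i)) ->
  U (\sum_(i <- r | P i) f i).
Proof.
move=> subU Uf; elim/big_ind: _ => // [|x y]; first exact: subspace0.
exact: subspaceD.
Qed.

Lemma lspan_subspace A : is_subspace (lspan A).
Proof.
split=> [U [subU _] | a x y Ax Ay U [subU sAU]]; first exact: subspace0.
by case: (subU) => _; apply; [apply: Ax | apply: Ay].
Qed.

Lemma sub_lspan A : A `<=` lspan A.
Proof. exact: sub_gen_smallest. Qed.

Lemma lspan_sub A U : is_subspace U -> A `<=` U -> lspan A `<=` U.
Proof. by move=> subU sAU x; apply. Qed.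

Lemma lspanS A U : A `<=` U -> lspan A `<=` lspan U.
Proof.
move=> sAU; apply: lspan_sub (lspan_subspace U) _.
exact: subset_trans (@sub_lspan U).
Qed.

Lemma lspan_range d (b : 'I_d -> W) x :
  lspan (range b) x -> exists c : 'I_d -> K, x = \sum_(i < d) c i *: b i.
Proof.
pose U := [set x | exists c : 'I_d -> K, x = \sum_(i < d) c i *: b i].
apply: (@lspan_sub _ U) => [|_ [i _ <-]]; first split.
- by exists (fun=> 0); rewrite big1 // => i _; rewrite scale0r.
- move=> a _ _ [c1 ->] [c2 ->]; exists (fun i => a * c1 i + c2 i).
  rewrite scaler_sumr -big_split; apply: eq_bigr => i _ /=.
  by rewrite scalerDl scalerA.
exists (fun j => (j == i)%:R); rewrite (bigD1 i) //= eqxx scale1r big1 ?addr0 //.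
by move=> j /negPf ->; rewrite scale0r.
Qed.

(** If [d > k], the coordinate matrix has more rows than columns, and a nonzero vector of its left
    kernel is a linear relation among the [b i]. *)
Lemma lin_indep_leq d k (b : 'I_d -> W) (s : 'I_k -> W) :
  lin_indep b -> (forall i, lspan (range s) (b i)) -> (d <= k)%N.
Proof.
move=> free_b sb.
have /(_ _)/lspan_range/cid-/all_tag[c bE] := sb.
pose M := \matrix_(i, j) c i j.
apply: contraT; rewrite -ltnNge => lt_kd.
have /rowV0Pn[v vM v0] : kermx M != 0.
  by rewrite -mxrank_eq0 mxrank_ker subn_eq0 -ltnNge (leq_ltn_trans (rank_leq_col M)).
case/eqP: v0; apply/rowP => i; rewrite mxE; move: i; apply: free_b.
under eq_bigr do rewrite bE scaler_sumr.
rewrite exchange_big big1 // => j _ /=.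
under eq_bigr do rewrite scalerA.
rewrite -scaler_suml; move/sub_kermxP/rowP/(_ j): vM; rewrite !mxE.
by under eq_bigr do rewrite mxE; move->; rewrite scale0r.
Qed.

Lemma has_dim_leq U A d k :
  U `<=` A -> has_dim U d -> has_dim A k -> (d <= k)%N.
Proof.
move=> sUA [b [free_b bU]] [s [_ sA]]; apply: (lin_indep_leq (s := s) free_b) => i.
by rewrite sA; apply: sUA; rewrite -bU; apply: sub_lspan; exists i.
Qed.

Lemma dimK_leq U A : U `<=` A -> finite_dim A -> (dimK U <= dimK A)%N.
Proof.
move=> sUA [k Ak]; rewrite /dimK.
(* If [U] has no dimension, [dimK U] is the default 0 and the inequality is trivial. *)
case: xgetP => [d _ /= Ud | _ //].
case: xgetP => [k' _ /= Ak' | /(_ k)//].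
exact: has_dim_leq sUA Ud Ak'.
Qed.

Lemma lin_indep_ext d (b : 'I_d -> W) x :
    lin_indep b -> ~ lspan (range b) x ->
  lin_indep (fun i => if unlift ord0 i is Some j then b j else x).
Proof.
move=> free_b bx c; rewrite big_ord_recl unlift_none.
under eq_bigr do rewrite liftK.
set y := \sum_(i < d) _.
have subS := lspan_subspace (range b).
have span_y : lspan (range b) y.
  apply: (subspace_sum _ subS) => i _; apply: (subspaceZ _ subS).
  by apply: sub_lspan; exists i.
have [c0 | c0 eq0] := eqVneq (c ord0) 0.
  rewrite c0 scale0r add0r => /free_b cS i.
  by case: (unliftP ord0 i) => [j|] ->.
case: bx; rewrite -[x](scalerK c0).
rewrite (_ : c ord0 *: x = 0 - y); last by rewrite -eq0 addrK.
by apply: (subspaceZ _ subS); apply: (subspaceB subS) => //; apply: subspace0.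
Qed.

(** An independent family in [U] has at most [size s] members; one of maximal length spans, since
    [lin_indep_ext] would otherwise enlarge it. *)
Lemma finite_dim_sub U (s : seq W) :
  is_subspace U -> U `<=` lspan [set x | x \in s] -> finite_dim U.
Proof.
move=> subU sUs.
pose P d := `[< exists b : 'I_d -> W, lin_indep b /\ forall i, U (b i) >].
have P0 : exists d, P d.
  by exists 0%N; apply/asboolP; exists (fun=> 0); split => [c _|] [].
have leP d : P d -> (d <= size s)%N.
  move=> /asboolP[b [free_b Ub]].
  apply: (@lin_indep_leq _ _ _ (fun i : 'I_(size s) => nth 0 s i) free_b) => i.
  apply: lspanS (sUs _ (Ub i)) => x /= xs.
  have ltx : (index x s < size s)%N by rewrite index_mem.
  by exists (Ordinal ltx) => //=; rewrite nth_index.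
case: (ex_maxnP P0 leP) => d /asboolP[b [free_b Ub]] max_d.
exists d, b; split=> //; apply/seteqP; split.
  by apply: lspan_sub => // _ [i _ <-].
move=> x Ux; apply: contrapT => bx.
have /max_d : P d.+1; last by rewrite ltnn.
apply/asboolP; exists (fun i => if unlift ord0 i is Some j then b j else x).
split; first exact: lin_indep_ext.
by move=> i; case: (unlift ord0 i).
Qed.

End Subspaces.

(** * The filtration by powers of a generating space *)

Section GradedSum.
Variables (K : fieldType) (W : lmodType K).
Implicit Types (H : nat -> set W).

Lemma big_ord_pad N M (f : nat -> W) : (N <= M)%N ->
  \sum_(i < N) f i = \sum_(i < M) (if (i < N)%N then f i else 0).
Proof. by move=> leNM; rewrite (big_ord_widen M f) // big_mkcond. Qed.

(** Serves both for the filtration [vpow_sum] and for the graded subalgebra of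
    [degree_sub_vpow_sum]. *)
Definition sum_lt H N : set W :=
  [set x | exists f, (forall i, H i (f i)) /\ x = \sum_(i < N) f i].

Definition sum_all H : set W := [set x | exists N, sum_lt H N x].

Lemma sum_lt_subspace H N :
  (forall i, is_subspace (H i)) -> is_subspace (sum_lt H N).
Proof.
move=> subH; split=> [|a _ _ [f [Hf ->]] [g [Hg ->]]].
  by exists (fun=> 0); split=> [i|]; [apply: subspace0 | rewrite big1].
exists (fun i => a *: f i + g i); split=> [i|].
  by case: (subH i) => _; apply.
by rewrite big_split scaler_sumr.
Qed.

Lemma sum_ltS H N M : (forall i, is_subspace (H i)) -> (N <= M)%N ->
  sum_lt H N `<=` sum_lt H M.
Proof.
move=> subH leNM _ [f [Hf ->]].
exists (fun i => if (i < N)%N then f i else 0); split; last exact: big_ord_pad.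
by move=> i; case: ifP => // _; apply: subspace0.
Qed.

Lemma sum_lt_homog H N i x : (forall i, is_subspace (H i)) -> (i < N)%N ->
  H i x -> sum_lt H N x.
Proof.
move=> subH lt_iN Hx; exists (fun j => if j == i then x else 0); split.
  by move=> j; case: eqP => [-> // | _]; apply: subspace0.
rewrite (bigD1 (Ordinal lt_iN)) //= eqxx big1 ?addr0 // => j.
by rewrite -val_eqE /= => /negPf ->.
Qed.

Lemma sum_all_subspace H :
  (forall i, is_subspace (H i)) -> is_subspace (sum_all H).
Proof.
move=> subH; split=> [|a x y [N Hx] [M Hy]].
  by exists 0%N; apply: (subspace0 (sum_lt_subspace 0 subH)).
exists (maxn N M); case: (sum_lt_subspace (maxn N M) subH) => _; apply.
  by apply: sum_ltS Hx => //; apply: leq_maxl.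
by apply: sum_ltS Hy => //; apply: leq_maxr.
Qed.

End GradedSum.

Section Filtration.
Variables (K : fieldType) (R : assocAlg K).
Implicit Types (x y e : R) (A B U V : set R).

Lemma amul0l x : amul 0 x = 0.
Proof. by rewrite -[X in amul X _](scale0r 0) amulZl scale0r. Qed.

Lemma amul0r x : amul x 0 = 0.
Proof. by rewrite -[X in amul _ X](scale0r 0) amulZr scale0r. Qed.

Lemma amul_suml (I : Type) (r : seq I) (f : I -> R) x :
  amul (\sum_(i <- r) f i) x = \sum_(i <- r) amul (f i) x.
Proof.
by apply: (big_morph (fun y => amul y x)) => [y z|]; rewrite ?amulDl ?amul0l.
Qed.

Lemma amul_sumr (I : Type) (r : seq I) (f : I -> R) x :
  amul x (\sum_(i <- r) f i) = \sum_(i <- r) amul x (f i).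
Proof.
by apply: (big_morph (amul x)) => [y z|]; rewrite ?amulDr ?amul0r.
Qed.

Lemma is_one_unique e e' : is_one e -> is_one e' -> e = e'.
Proof. by move=> /(_ e')[_ e'e] /(_ e)[ee' _]; rewrite -ee' e'e. Qed.

Lemma lspan_amul A B U : is_subspace U ->
    (forall x y, A x -> B y -> U (amul x y)) ->
  forall x y, lspan A x -> lspan B y -> U (amul x y).
Proof.
move=> subU ABU x y Ax; move: y; apply: lspan_sub.
  split=> [|a y z /= Uy Uz]; first by rewrite /= amul0r; apply: subspace0.
  by rewrite amulDr amulZr; case: subU => _; apply.
move=> y By /=; move: x Ax; apply: lspan_sub.
  split=> [|a x z /= Ux Uz]; first by rewrite /= amul0l; apply: subspace0.
  by rewrite amulDl amulZl; case: subU => _; apply.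
by move=> x Ax; apply: ABU.
Qed.

Lemma vpow_subspace V i : is_subspace (vpow V i).
Proof. exact: lspan_subspace. Qed.

Lemma foldl_amul x y (s : seq R) :
  foldl (@amul K R) (amul x y) s = amul x (foldl (@amul K R) y s).
Proof. by elim: s y => //= z s IHs y; rewrite -amulA IHs. Qed.

Lemma products_amul V i j x y :
  products V i x -> products V j y -> products V (i + j) (amul x y).
Proof.
case: i j => [|i] [|j] /=.
- by move=> x1 /[dup] y1 /(_ x)[_ ->].
- by move=> /(_ y)[-> _].
- by move=> + /(_ x)[_ ->]; rewrite addn0.
move=> [z [s [Vz Vs sz ->]]] [t [r [Vt Vr sr ->]]].
exists z, (s ++ t :: r); split=> //.
- move=> u; rewrite mem_cat inE => /or3P[/Vs // | /eqP -> // | /Vr //].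
- by rewrite size_cat /= sz sr addnS.
by rewrite foldl_cat /= foldl_amul.
Qed.

Lemma vpow_amul V i j x y :
  vpow V i x -> vpow V j y -> vpow V (i + j) (amul x y).
Proof.
apply: lspan_amul; first exact: vpow_subspace.
by move=> u v Vu Vv; apply: sub_lspan; apply: products_amul.
Qed.

Lemma vpow_sumE V n : vpow_sum V n = sum_lt (vpow V) n.+1.
Proof. by []. Qed.

Lemma vpow_sum_subspace V n : is_subspace (vpow_sum V n).
Proof. by rewrite vpow_sumE; apply: sum_lt_subspace => i; apply: vpow_subspace. Qed.

Lemma vpow_sumS V m n : (m <= n)%N -> vpow_sum V m `<=` vpow_sum V n.
Proof. by move=> lemn; apply: sum_ltS => // i; apply: vpow_subspace. Qed.

Lemma vpow_sub_vpow_sum V i n : (i <= n)%N -> vpow V i `<=` vpow_sum V n.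
Proof.
move=> lein x Vx; rewrite vpow_sumE; apply: (sum_lt_homog (i := i)) => // j.
exact: vpow_subspace.
Qed.

Lemma vpow_sum_amul V m n x y :
  vpow_sum V m x -> vpow_sum V n y -> vpow_sum V (m + n) (amul x y).
Proof.
have subF := vpow_sum_subspace V (m + n).
move=> [f [Vf ->]] [g [Vg ->]]; rewrite amul_suml.
apply: (subspace_sum _ subF) => i _; rewrite amul_sumr.
apply: (subspace_sum _ subF) => j _; apply: (@vpow_sub_vpow_sum _ (i + j)).
  by rewrite leq_add // -ltnS.
exact: vpow_amul.
Qed.

Lemma is_one_vpow_sum V e n : is_one e -> vpow_sum V n e.
Proof.
by move=> e1; apply: (@vpow_sub_vpow_sum _ 0%N) => //; apply: sub_lspan.
Qed.

Lemma sub_vpow_sum V n : (0 < n)%N -> V `<=` vpow_sum V n.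
Proof.
move=> n0 x Vx; apply: (@vpow_sub_vpow_sum _ 1%N) => //.
by apply: sub_lspan; exists x, [::].
Qed.

Lemma generates_sub V S : generates V -> is_subalg S -> V `<=` S -> forall x, S x.
Proof.
move=> genV algS sVS x.
by have : [set: R] x by []; rewrite -genV; apply.
Qed.

(** The union of the filtration is a subalgebra containing [V]. *)
Lemma vpow_sum_exhaust V x : generates V -> exists n, vpow_sum V n x.
Proof.
move=> genV; move: x; apply: (@generates_sub V [set x | exists n, vpow_sum V n x] genV).
  split.
  - split=> [|a x y [m Vx] [n Vy]].
      by exists 0%N; apply: (subspace0 (vpow_sum_subspace V 0)).
    exists (m + n)%N; case: (vpow_sum_subspace V (m + n)) => _; apply.
      by apply: vpow_sumS Vx; apply: leq_addr.
    by apply: vpow_sumS Vy; apply: leq_addl.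
  - by move=> x y [m Vx] [n Vy]; exists (m + n)%N; apply: vpow_sum_amul.
  - by move=> e e1; exists 0%N; apply: is_one_vpow_sum.
by move=> x Vx; exists 1%N; apply: sub_vpow_sum.
Qed.

(** Weaker than [finite_dim]: [U] need not be a subspace, so sets of products qualify. *)
Definition fin_spanned U : Prop :=
  exists s : seq R, U `<=` lspan [set x | x \in s].

Lemma fin_spanned_amul U A :
    fin_spanned U -> fin_spanned A ->
  exists s : seq R, forall x y, U x -> A y -> lspan [set z | z \in s] (amul x y).
Proof.
move=> [s sU] [t tA]; exists [seq amul x y | x <- s, y <- t] => x y /sU xs /tA.
move: xs; apply: lspan_amul; first exact: lspan_subspace.
move=> {}x {}y xs yt; apply: sub_lspan.
by apply/allpairsP; exists (x, y).
Qed.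

Lemma vpow_fin_spanned V i : fin_spanned V -> fin_spanned (vpow V i).
Proof.
move=> finV.
suff [s sV] : fin_spanned (products V i).
  by exists s; apply: lspan_sub => //; apply: lspan_subspace.
case: i => [|i].
  (* An identity is unique, so one entry suffices; if there is none, the entry is a default value
     and the set to be spanned is empty. *)
  exists [:: xget 0 [set e : R | is_one e]] => e e1; apply: sub_lspan => /=.
  rewrite inE; apply/eqP.
  by case: xgetP => [e' _ /(is_one_unique e1) | /(_ e e1)].
elim: i => [|i [s IHi]].
  case: finV => s sV; exists s => _ [x [r [Vx _ /size0nil -> ->]]].
  exact: sV.
have [t st] := fin_spanned_amul (ex_intro _ s IHi : fin_spanned _) finV.
exists t => _ [x [r [Vx Vr szr ->]]].
case/lastP: r Vr szr => // r z Vr; rewrite size_rcons => -[szr].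
rewrite foldl_rcons; apply: st; last by apply: Vr; rewrite mem_rcons mem_head.
by exists x, r; split=> // u ur; apply: Vr; rewrite mem_rcons inE ur orbT.
Qed.

Lemma vpow_sum_finite_dim V n : fin_spanned V -> finite_dim (vpow_sum V n).
Proof.
move=> finV; suff [s sV] : fin_spanned (vpow_sum V n).
  by apply: finite_dim_sub sV; apply: vpow_sum_subspace.
have /(_ _)/cid-/all_tag[s sV] := fun i => vpow_fin_spanned i finV.
have s_sub (i : 'I_n.+1) x :
    x \in s i -> x \in flatten [seq s i | i <- iota 0 n.+1].
  by move=> xs; apply/flattenP; exists (s i); rewrite // map_f // mem_iota /=.
exists (flatten [seq s i | i <- iota 0 n.+1]) => _ [f [Vf ->]].
apply: (subspace_sum _ (lspan_subspace _)) => i _.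
exact: lspanS (s_sub i) _ (sV i _ (Vf i)).
Qed.

End Filtration.

(** * Growth of the homogeneous components *)

Section GradedGrowth.
Variables (K : fieldType) (R : assocAlg K) (G : nat -> set R) (V : set R).
Hypothesis hG : is_grading G.

Let subG := grading_subspace hG.

(** Uniqueness of homogeneous components: both decompositions of [x] are padded to a common length
    and subtracted. *)
Lemma grading_component N (f : nat -> R) n x :
    (forall i, G i (f i)) -> G n x -> x = \sum_(i < N) f i ->
  x = if (n < N)%N then f n else 0.
Proof.
move=> Gf Gx xE.
pose h i := (if (i < N)%N then f i else 0) - (if i == n then x else 0).
have Gh i : G i (h i).
  apply: subspaceB => //.
    by case: ifP => // _; apply: subspace0.
  by case: eqP => [-> // | _]; apply: subspace0.
have sum_h : \sum_(i < maxn N n.+1) h i = 0.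
  rewrite sumrB -big_ord_pad ?leq_maxl // -xE.
  have ltn_max : (n < maxn N n.+1)%N by rewrite leq_maxr.
  rewrite (bigD1 (Ordinal ltn_max)) //= eqxx big1 ?addr0 ?subrr // => j.
  by rewrite -val_eqE /= => /negPf ->.
have /eqP := grading_direct hG Gh sum_h (leq_maxr N n.+1).
by rewrite /h eqxx subr_eq0 => /eqP.
Qed.

(** Comparing components of degree [n] in [e x = x] shows that the degree 0 part [f0] of [e] fixes
    every homogeneous [x] from the left. Hence [f0 e = e], while [f0 e = f0]. *)
Lemma is_one_degree0 e : is_one e -> G 0%N e.
Proof.
move=> e1; have [N [f [Gf eE]]] := grading_span hG e.
pose f0 := if (0 < N)%N then f 0%N else 0.
have Gf0 : G 0%N f0 by rewrite /f0; case: ifP => // _; apply: subspace0.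
have f0_homog n x : G n x -> amul f0 x = x.
  move=> Gx; pose h j := if (n <= j)%N then amul (f (j - n)%N) x else 0.
  have Gh j : G j (h j).
    rewrite /h; case: leqP => [/subnK {1}<- | _]; last exact: subspace0.
    exact: grading_mul.
  have xE : x = \sum_(j < n + N) h j.
    rewrite big_split_ord /= big1 ?add0r => [|i _]; last first.
      by rewrite /h leqNgt ltn_ord.
    under eq_bigr do rewrite /h leq_addr addKn.
    by rewrite -amul_suml -eE; case: (e1 x).
  rewrite [RHS](grading_component Gh Gx xE) /h leqnn subnn -ltn_subLR // subnn.
  by rewrite /f0; case: ifP; rewrite ?amul0l.
have -> : e = f0 ; last by [].
have [_ <-] := e1 f0.
rewrite {2}eE amul_sumr [LHS]eE; apply: eq_bigr => i _.
by rewrite (f0_homog i).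
Qed.

Hypothesis hG0 : G 0%N = [set 0] \/ degree0_is_field G.
Hypothesis hVfin : finite_dim V.
Hypothesis hVgen : generates V.

Lemma degree0_sub_vpow_sum n : G 0%N `<=` vpow_sum V n.
Proof.
have subF := vpow_sum_subspace V n.
case: hG0 => [-> _ -> | [e [_ e1 ->]] _ [c _ <-]]; first exact: subspace0.
by apply: (subspaceZ _ subF); apply: is_one_vpow_sum.
Qed.

Lemma vpow_sum_exhaust_finite (I : finType) (f : I -> R) :
  exists k, forall i, vpow_sum V k (f i).
Proof.
have /(_ _)/cid-/all_tag[k Vk] := fun i => vpow_sum_exhaust (f i) hVgen.
exists (\max_i k i)%N => i; apply: vpow_sumS (Vk i).
exact: leq_bigmax.
Qed.

(* The homogeneous components of a basis of V all lie in some V^0 + ... + V^k,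
   and those of degree 0 are scalars, so a product of total degree n needs at
   most n of the others. *)
Lemma degree_sub_vpow_sum : exists k, forall n, G n `<=` vpow_sum V (k * n).
Proof.
have [d [b [_ bV]]] := hVfin.
have /(_ _)/cid-/all_tag[N /(_ _)/cid-/all_tag[f bE]] :=
  fun i => grading_span hG (b i).
pose M := (\max_i N i)%N.
have [k Vk] := vpow_sum_exhaust_finite (fun ij : 'I_d * 'I_M => f ij.1 ij.2).
(* The sum of the [H n] is a subalgebra containing [V], hence all of [R]; its component of degree
   [n] is then all of [G n]. *)
pose H n := G n `&` vpow_sum V (k * n).
have subH n : is_subspace (H n).
  have [F0 Flin] := vpow_sum_subspace V (k * n); have [G0 Glin] := subG n.
  by split=> // a x y [Gx Fx] [Gy Fy]; split; [apply: Glin | apply: Flin].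
have subS := sum_all_subspace subH.
have SH n x : H n x -> sum_all H x.
  by move=> Hx; exists n.+1; apply: (sum_lt_homog (i := n)).
exists k => n x Gx.
have [||L [g [Hg xE]]] := @generates_sub _ _ V (sum_all H) hVgen _ _ x; last 1 first.
- rewrite (grading_component (fun i => (Hg i).1) Gx xE).
  case: ifP => _; first by case: (Hg n).
  exact: subspace0 (vpow_sum_subspace _ _).
- split=> //.
  + move=> _ _ [L [g [Hg ->]]] [L' [g' [Hg' ->]]]; rewrite amul_suml.
    apply: (subspace_sum _ subS) => i _; rewrite amul_sumr.
    apply: (subspace_sum _ subS) => j _; apply: (SH (i + j)%N).
    have [Gg Fg] := Hg i; have [Gg' Fg'] := Hg' j.
    by split; [apply: grading_mul | rewrite mulnDr; apply: vpow_sum_amul].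
  + move=> e e1; apply: (SH 0%N); split; first exact: is_one_degree0.
    exact: is_one_vpow_sum.
rewrite -bV; apply: lspan_sub => // _ [i _ <-].
have [Gf ->] := bE i; apply: (subspace_sum _ subS) => -[j ltj] _ /=.
(* In degree 0 the allowed length [k * 0] is 0, so the assumption on [G 0] is used; in degree [j.+1]
   length [k] is enough. *)
apply: (SH j); split=> //; case: j ltj => [|j] ltj.
  by apply: degree0_sub_vpow_sum.
have ltjM : (j.+1 < M)%N by apply: leq_trans ltj _; apply: leq_bigmax.
by apply: vpow_sumS (Vk (i, Ordinal ltjM)); apply: leq_pmulr.
Qed.

Lemma dim_leq_growth : exists k, forall n, (dimK (G n) <= growth V (k * n))%N.
Proof.
have [k sub_k] := degree_sub_vpow_sum; exists k => n.
apply: dimK_leq (sub_k n) _; apply: vpow_sum_finite_dim.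
have [d [b [_ bV]]] := hVfin; exists (codom b); rewrite -bV.
apply: lspanS => _ [i _ <-] /=; exact: codom_f.
Qed.

End GradedGrowth.

(** * From the Gelfand-Kirillov dimension to polynomial growth, and the conclusion *)

Lemma limn_esup_lty_ubound (RR : realType) (u : nat -> RR) :
    (limn_esup (fun n => (u n)%:E) < +oo)%E ->
  exists A N : nat, forall n, (N <= n)%N -> u n <= A%:R.
Proof.
(* The upper limit is an infimum of suprema over sets containing a tail, so one of these suprema is
   below [+oo]. *)
move=> /ereal_inf_lt[_ [S [N _ NS] <-]] sup_lt.
have sup_ge n : (N <= n)%N -> ((u n)%:E <= ereal_sup ((fun n => (u n)%:E) @` S))%E.
  by move=> leNn; apply: ereal_sup_ubound; exists n => //; apply: NS.
case: (ereal_sup _) sup_lt sup_ge => [y|//|] _ sup_ge.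
  exists (Num.bound `|y|), N => n /sup_ge; rewrite lee_fin => /le_trans; apply.
  by apply: le_trans (ler_norm _) (ltW (archi_boundP _)).
by have := sup_ge N (leqnn N); rewrite leeNy_eq.
Qed.

Lemma GKdim_growth_leq (RR : realType) (K : fieldType) (R : assocAlg K) (V : set R) :
    (GKdim RR V < +oo)%E ->
  exists A N : nat, forall n, (N <= n)%N -> (growth V n <= n ^ A)%N.
Proof.
(* The threshold [N.+2] makes [ln n] positive, so the bound [A] on the quotient of logarithms can be
   exponentiated. *)
move=> /limn_esup_lty_ubound[A [N leA]]; exists A, N.+2 => n ltNn.
have [-> // | g0] := posnP (growth V n).
have n1 : (1 < n)%N by apply: leq_trans ltNn.
have lnn : 0 < ln n%:R :> RR by rewrite ln_gt0 // ltr1n.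
have n0 : 0 < n%:R :> RR by rewrite ltr0n ltnW.
have := leA n (leq_trans (leqW (leqnSn N)) ltNn).
rewrite ler_pdivrMr // mulr_natl -lnXn // ler_ln ?posrE ?exprn_gt0 ?ltr0n ?(ltnW n1) //.
by rewrite -natrX ler_nat.
Qed.

Theorem theorem4p2 (RR : realType) (K : fieldType) (R : assocAlg K)
    (G : nat -> set R) (V : set R)
    (hG : is_grading G)
    (hG0 : G 0%N = [set 0] \/ degree0_is_field G)
    (hVfin : finite_dim V) (hVgen : generates V)
    (hGK : (GKdim RR V < +oo)%E) :
  fps_rational (hilbert_series G) \/ fps_transcendental (hilbert_series G).
Proof.
have [k le_dim] := dim_leq_growth hG hG0 hVfin hVgen.
have [A [N leA]] := GKdim_growth_leq hGK.
have [alg | ] := pselect (fps_algebraic (hilbert_series G)); last by right.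
(* The three summands cover [k * n >= N], the finitely many [n < N], and the case [k = 0], where
   [k * n] may stay below the threshold of [leA]. *)
left; pose D := (k ^ A + \sum_(i < N) dimK (G i) + growth V 0)%N.
apply: (@fatou_polynomial_growth (fun n => dimK (G n)) D A) => // n.
have nA : (0 < n.+1 ^ A)%N by rewrite expn_gt0.
have [ltnN | leNn] := ltnP n N.
  apply: leq_trans (leq_pmulr _ nA).
  by rewrite /D (bigD1 (Ordinal ltnN)) //=; lia.
have [k0 | k_gt0] := posnP k.
  apply: leq_trans (leq_pmulr _ nA).
  by have := le_dim n; rewrite k0 mul0n /D; lia.
apply: (@leq_trans (k ^ A * n.+1 ^ A)); last by rewrite leq_mul2r /D; lia.
apply: leq_trans (le_dim n) _.
apply: leq_trans (leA _ _) _; first by apply: leq_trans leNn (leq_pmull _ _).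
by rewrite expnMn leq_mul2l; case: (A) => [|m]; rewrite ?expn0 ?leq_exp2r ?leqnSn ?orbT.
Qed.
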